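(* Let $k$ be an infinite field, let $n\ge 4$ and let $A=\{0=a_0<a_1<\dots<a_{n-1}=d\}\subset\mathbb{N}$ with $\gcd(a_1,\dots,a_{n-1})=1$. Let $\mathcal{S}_1$ and $\mathcal{S}_2$ be the numerical semigroups generated by $A$ and by $d-A=\{d-a: a\in A\}$, let $c_i$ be the conductor of $\mathcal{S}_i$ and let $C_i=\mathcal{S}_i\cap[0,c_i-2]$, $i=1,2$. Then the least integer $\sigma$ such that the decomposition $$sA = C_1\sqcup[c_1,sd-c_2]\sqcup(sd-C_2)$$ holds for all $s\ge\sigma$ is $$\sigma=\max\left\{\operatorname{r}(k[\mathcal{C}_A]),\ \left\lceil\frac{c_1+c_2}{d}\right\rceil\right\},$$ where $\operatorname{r}(k[\mathcal{C}_A])$ is the regularity of the Hilbert function of $k[\mathcal{C}_A]$.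
   Context: $\mathbb{N}=\{0,1,2,\dots\}$. For $s\in\mathbb{N}$, the $s$-fold sumset is $0A=\{0\}$ and $sA=\{a_{i_1}+\dots+a_{i_s}: 0\le i_1\le\dots\le i_s\le n-1\}$ for $s\ge1$; $\sigma$ is sought among $s\in\mathbb{N}$, since $sA$ is only defined for such $s$. The notation $[a,b]=\{m\in\mathbb{Z}: a\le m\le b\}$ is used only for integers $a\le b$ when it denotes the central interval $[c_1,sd-c_2]$; that is, saying that the decomposition holds for $s$ includes the requirement $c_1\le sd-c_2$ (while $[0,c_i-2]$ is empty if $c_i<2$). $sd-C_2=\{sd-c:c\in C_2\}$, and $\sqcup$ denotes disjoint union. The conductor of a numerical semigroup $T$ is the least $c\in\mathbb{N}$ such that every integer $m\ge c$ belongs to $T$ (so it is $0$ if $T=\mathbb{N}$). $k[\mathcal{C}_A]=k[x_0,\dots,x_{n-1}]/I(\mathcal{C}_A)$, where $I(\mathcal{C}_A)$ is the kernel of the $k$-algebra homomorphism $k[x_0,\dots,x_{n-1}]\to k[u,v]$, $x_i\mapsto u^{a_i}v^{d-a_i}$; it is standard graded ($\deg x_i=1$) and is the homogeneous coordinate ring of the projective monomial curve $\mathcal{C}_A\subset\mathbb{P}^{n-1}_k$ parametrized by $(v^d:u^{a_1}v^{d-a_1}:\dots:u^{a_{n-2}}v^{d-a_{n-2}}:u^d)$. For a standard graded $k$-algebra $R$, $\operatorname{r}(R)$ is the least integer $r$ such that the Hilbert function and the Hilbert polynomial of $R$ agree at every integer $s\ge r$. *)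

(* Defs.v *)
From HB Require Import structures.
From mathcomp Require Import all_boot all_order all_algebra ring_quotient.
From mathcomp Require Import mpoly.
From mathcomp Require Import classical_sets cardinality.

Set Implicit Arguments.
Unset Strict Implicit.
Unset Printing Implicit Defensive.

Import Order.TTheory GRing.Theory Num.Theory.

Local Open Scope classical_set_scope.
Local Open Scope ring_scope.
Local Open Scope quotient_scope.

Definition is_least {disp : Order.disp_t} {T : porderType disp}
    (S : set T) (x : T) : Prop :=
  S x /\ forall y, S y -> (x <= y)%O.

Section Semigroups.
Local Open Scope nat_scope.

Definition sumset n (a : n.-tuple nat) (s : nat) : set nat :=
  [set m | exists2 t : s.-tuple 'I_n,
     sorted leq (map val t) & m = \sum_(i <- t) tnth a i].

Definition semigroup_gen n (a : n.-tuple nat) : set nat :=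
  [set m | exists l : 'I_n -> nat, m = \sum_(i < n) l i * tnth a i].

(* The set d - A; it is only used when every a_i is at most d. *)
Definition dual_tuple n (d : nat) (a : n.-tuple nat) : n.-tuple nat :=
  [tuple d - tnth a i | i < n].

Definition is_conductor (T : set nat) (c : nat) : Prop :=
  is_least [set c' : nat | forall m : nat, c' <= m -> T m] c.

(* T `&` [0, c - 2], which is empty for c < 2. *)
Definition below_conductor (T : set nat) (c : nat) : set nat :=
  T `&` [set m | m + 2 <= c].

(* The first conjunct says that c1 <= s d - c2 over the integers, so that none
   of the natural-number subtractions below is truncated. *)
Definition sumset_decomposition n (a : n.-tuple nat) (d c1 c2 s : nat) : Prop :=
  let L := below_conductor (semigroup_gen a) c1 in
  let M := [set m | c1 <= m <= s * d - c2] in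
  let U := [set s * d - c | c in
              below_conductor (semigroup_gen (dual_tuple d a)) c2] in
  [/\ c1 + c2 <= s * d,
      sumset a s = L `|` M `|` U,
      L `&` M = set0, L `&` U = set0 & M `&` U = set0].

End Semigroups.

Definition has_dim (k : fieldType) (V : lmodType k) (W : set V) (m : nat) : Prop :=
  exists b : 'I_m -> V,
  [/\ forall i, W (b i),
      forall c : 'I_m -> k, \sum_i c i *: b i = 0 -> forall i, c i = 0
    & forall x, W x -> exists c : 'I_m -> k, x = \sum_i c i *: b i].

Definition is_hilbert_function (k : fieldType) (V : lmodType k)
    (gr : int -> set V) (H : int -> nat) : Prop :=
  forall s, has_dim (gr s) (H s).

Definition agree_from (H : int -> nat) (P : {poly rat}) (r : int) : Prop :=
  forall s : int, r <= s -> P.[s%:~R] = (H s)%:R.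

Definition is_hilbert_polynomial (H : int -> nat) (P : {poly rat}) : Prop :=
  exists r, agree_from H P r.

Definition is_hilbert_regularity (k : fieldType) (V : lmodType k)
    (gr : int -> set V) (r : int) : Prop :=
  exists H P, [/\ is_hilbert_function gr H, is_hilbert_polynomial H P
                & is_least [set r' : int | agree_from H P r'] r].

Section CoordinateRing.
Variables (k : fieldType) (n : nat) (a : n.-tuple nat) (d : nat).

(* x_i |-> u ^ a_i v ^ (d - a_i), with u = 'X_0 and v = 'X_1. *)
Definition curve_param (p : {mpoly k[n]}) : {mpoly k[2]} :=
  p \mPo [tuple 'X_0 ^+ tnth a i * 'X_1 ^+ (d - tnth a i) | i < n].

Definition curve_ideal : {pred {mpoly k[n]}} :=
  [pred p | curve_param p == 0].

Fact curve_ideal_closed : idealr_closed curve_ideal.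
Proof.
split=> [||p q r].
- by rewrite inE /= /curve_param comp_mpoly0.
- by rewrite inE /= /curve_param comp_mpoly1 oner_eq0.
- rewrite !inE => /eqP Eq /eqP Er; rewrite /= /curve_param comp_mpolyD rmorphM.
  by rewrite /curve_param in Eq Er; rewrite /= Eq Er mulr0 addr0.
Qed.

HB.instance Definition _ :=
  isIdealr.Build {mpoly k[n]} curve_ideal curve_ideal_closed.

Definition coord_ring : Type := {ideal_quot curve_ideal}.

HB.instance Definition _ := GRing.ComNzRing.on coord_ring.

Definition coord_proj (p : {mpoly k[n]}) : coord_ring :=
  \pi_{ideal_quot curve_ideal} p.

Fact coord_projD : {morph coord_proj : p q / p + q}.
Proof. by move=> p q; rewrite /coord_proj rmorphD. Qed.

Fact coord_projM : {morph coord_proj : p q / p * q}.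
Proof. by move=> p q; rewrite /coord_proj rmorphM. Qed.

Fact coord_proj1 : coord_proj 1 = 1.
Proof. by rewrite /coord_proj rmorph1. Qed.

Definition coord_scale (c : k) (x : coord_ring) : coord_ring :=
  coord_proj c%:MP * x.

Fact coord_scaleA c e x :
  coord_scale c (coord_scale e x) = coord_scale (c * e) x.
Proof. by rewrite /coord_scale mulrA -coord_projM -mpolyCM. Qed.

Fact coord_scale1 : left_id 1 coord_scale.
Proof. by move=> x; rewrite /coord_scale mpolyC1 coord_proj1 mul1r. Qed.

Fact coord_scaleDr : right_distributive coord_scale +%R.
Proof. by move=> c x y; rewrite /coord_scale mulrDr. Qed.

Fact coord_scaleDl x : {morph coord_scale^~ x : c e / c + e}.
Proof. by move=> c e; rewrite /coord_scale mpolyCD coord_projD mulrDl. Qed.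

HB.instance Definition _ := GRing.Zmodule_isLmodule.Build k coord_ring
  coord_scaleA coord_scale1 coord_scaleDr coord_scaleDl.

Fact coord_scaleAl (c : k) (x y : coord_ring) : c *: (x * y) = c *: x * y.
Proof. exact: mulrA. Qed.

HB.instance Definition _ :=
  GRing.Lmodule_isLalgebra.Build k coord_ring coord_scaleAl.
HB.instance Definition _ := GRing.Lalgebra_isComAlgebra.Build k coord_ring.

Definition coord_grading (s : int) : set coord_ring :=
  match s with
  | Posz m => [set coord_proj p | p in [set p | p \is m.-homog]]
  | Negz _ => [set 0]
  end.

End CoordinateRing.

(* Main.v *)
Require Import Defs.
From HB Require Import structures.
From mathcomp Require Import all_boot all_order all_algebra ring_quotient.
From mathcomp Require Import mpoly zify.
From mathcomp Require Import classical_sets cardinality boolp.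

Set Implicit Arguments.
Unset Strict Implicit.
Unset Printing Implicit Defensive.

Import Order.TTheory GRing.Theory Num.Theory.
Local Open Scope classical_set_scope.
Local Open Scope ring_scope.

(** Write [S1] and [S2] for the semigroups generated by [A] and [d - A], with
    [g1] and [g2] gaps.  Two facts combine.

    First, the Hilbert function of the curve at [s >= 0] is the number of
    elements of [sA].  Monomials of degree [s] in the [x_i] are sent to the
    monomials [u ^ m v ^ (s d - m)] with [m] in [sA]; choosing one preimage for
    each [m] gives a basis of the degree [s] part of the coordinate ring
    ([has_dim_coord_grading]).

    Second, [sA] always lies in the window
    [{m <= s d | m in S1 and s d - m in S2}].  When [c1 + c2 <= s d], the window
    is the union of the three blocks of the decomposition
    ([decomposition_window]) and has [s d + 1 - g1 - g2] elements, because the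
    gaps of [S1] and the reflected gaps of [S2] do not meet ([card_window]).  So
    the decomposition holds for [s] if and only if [c1 + c2 <= s d] and
    [#|sA| = s d + 1 - g1 - g2] ([decompositionP]).

    For all large [s] the window is contained in [sA] ([sumset_stable]).  Hence
    [P(s) = d s + 1 - g1 - g2] is the Hilbert polynomial, and the decomposition
    for [s] says exactly that [c1 + c2 <= s d] and that the Hilbert function and
    polynomial agree at [s].  The first condition is [s >= ceil ((c1 + c2) / d)];
    the second one holds from [s] on if and only if [s >= r].  It remains to see
    that the regularity [r], which is a priori an integer, is not negative: the
    Hilbert function vanishes at negative integers, where [P] is negative since
    [d > 1] ([line_poly_neg]). *)

(** * Sumsets and the semigroups they exhaust *)

Section Sumsets.
Local Open Scope nat_scope.

Lemma sum_multiplicity n (t : seq 'I_n) (f : 'I_n -> nat) :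
  \sum_(i <- t) f i = \sum_i count_mem i t * f i.
Proof.
elim: t => [|j t IHt]; first by rewrite big_nil big1.
rewrite big_cons IHt (bigD1 j) //= [in RHS](bigD1 j) //= eqxx mulnDl mul1n.
rewrite -addnA; congr (_ + (_ + _)); apply: eq_bigr => i ij.
by rewrite [j == i]eq_sym (negPf ij).
Qed.

(** A nondecreasing family of indices is the same thing as its multiplicities,
    which are easier to add and to compare with exponents of monomials. *)
Lemma sumsetP n (a : n.-tuple nat) s m :
  sumset a s m <->
  exists2 l : 'I_n -> nat, \sum_i l i = s & m = \sum_i l i * tnth a i.
Proof.
split=> [[t _ ->]|[l ls ->]].
  exists (fun i => count_mem i t); last by rewrite sum_multiplicity.
  under eq_bigr do rewrite -[count_mem _ _]muln1.
  by rewrite -sum_multiplicity sum1_size size_tuple.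
pose leI := relpre (val : 'I_n -> nat) leq.
pose u := flatten [seq nseq (l i) i | i <- index_enum 'I_n].
have sum_u f : \sum_(i <- sort leI u) f i = \sum_i l i * f i.
  rewrite (perm_big u) ?perm_sort //= big_flatten big_map.
  by apply: eq_bigr => i _; rewrite big_nseq iter_addn_0 mulnC.
have size_u : size (sort leI u) == s.
  rewrite -sum1_size sum_u -ls; apply/eqP.
  by apply: eq_bigr => i _; rewrite muln1.
exists (Tuple size_u); last by rewrite sum_u.
by rewrite sorted_map sort_sorted // => i j; apply: leq_total.
Qed.

Lemma sumset_semigroup n (a : n.-tuple nat) s m :
  sumset a s m -> semigroup_gen a m.
Proof. by case/sumsetP=> l _ ->; exists l. Qed.

Lemma sumset_add_copies n (a : n.-tuple nat) s m t i :
  sumset a s m -> sumset a (s + t) (m + t * tnth a i).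
Proof.
case/sumsetP=> l <- ->; apply/sumsetP.
exists (fun j => l j + t * (j == i)).
  rewrite big_split /= -big_distrr /=; congr (_ + _).
  by rewrite (bigD1 i) //= eqxx big1 ?addn0 ?muln1 // => j /negPf->.
under [RHS]eq_bigr do rewrite mulnDl.
rewrite big_split /=; congr (_ + _).
rewrite (bigD1 i) //= eqxx muln1 big1 ?addn0 // => j /negPf->.
by rewrite muln0.
Qed.

Section WithEndpoints.
Variables (n : nat) (a : n.-tuple nat) (d : nat) (i0 i1 : 'I_n).
Hypotheses (a_i0 : tnth a i0 = 0) (a_i1 : tnth a i1 = d).

Lemma sumset_leq s t m : s <= t -> sumset a s m -> sumset a t m.
Proof.
move=> le_st /(sumset_add_copies (t - s) i0).
by rewrite a_i0 muln0 addn0 subnKC.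
Qed.

(** The nonzero terms of a sum equal to [m] are at least [1], so that there
    are at most [m] of them; copies of the generator [0] make up the difference. *)
Lemma semigroup_sumset m : semigroup_gen a m -> sumset a m m.
Proof.
case=> l ml; pose l' i := if tnth a i == 0 then 0 else l i.
have l'm : m = \sum_i l' i * tnth a i.
  rewrite ml; apply: eq_bigr => i _; rewrite /l'.
  by case: eqP => // ->; rewrite !muln0.
apply: (@sumset_leq (\sum_i l' i)); last by apply/sumsetP; exists l'.
rewrite l'm; apply: leq_sum => i _; rewrite /l'.
by case: eqP => // /eqP; rewrite -lt0n => a_gt0; rewrite leq_pmulr.
Qed.

(** Below [c + d] the lemma [semigroup_sumset] applies; from there on,
    subtracting the generator [d] leaves an integer at least [c], hence in the
    semigroup, and uses up exactly one of the available summands. *)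
Lemma sumset_of_slack c s m :
    0 < d -> (forall m', c <= m' -> semigroup_gen a m') ->
    semigroup_gen a m -> (c + d) * d + m <= s * d ->
  sumset a s m.
Proof.
move=> d_gt0 Sc; elim/ltn_ind: m s => m IHm s Sm slack.
case: (ltnP m (c + d)) => [m_small|m_large].
  apply: sumset_leq (semigroup_sumset Sm); apply: leq_trans (ltnW m_small) _.
  by rewrite -(leq_pmul2r d_gt0); apply: leq_trans slack; apply: leq_addr.
case: s slack => [|s] slack; first by nia.
have sub_d : sumset a s (m - d) by apply: IHm => //; [| apply: Sc |]; nia.
have := sumset_add_copies 1 i1 sub_d; rewrite a_i1 mul1n addn1 subnK //.
exact: leq_trans (leq_addl c d) m_large.
Qed.

End WithEndpoints.

Section Duality.
Variables (n : nat) (a : n.-tuple nat) (d : nat).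
Hypothesis a_le_d : forall i, tnth a i <= d.

Lemma dual_tupleK : dual_tuple d (dual_tuple d a) = a.
Proof. by apply: eq_from_tnth => i; rewrite !tnth_mktuple subKn. Qed.

Lemma sumset_dual s m :
  sumset a s m -> m <= s * d /\ sumset (dual_tuple d a) s (s * d - m).
Proof.
case/sumsetP=> l ls ml.
have le_m : m <= s * d.
  rewrite ml -ls big_distrl; apply: leq_sum => i _.
  by rewrite leq_mul2l a_le_d orbT.
split=> //; apply/sumsetP; exists l => //.
apply/eqP; rewrite -(eqn_add2r m) subnK // {1}ml -big_split /= -ls big_distrl /=.
by apply/eqP; apply: eq_bigr => i _; rewrite tnth_mktuple -mulnDr subnK.
Qed.

End Duality.

(** The involution [A |-> d - A] reflects [sA] in the interval [[0, s d]], which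
    lets results about small elements be applied to large ones. *)
Lemma sumset_dualK n (a : n.-tuple nat) d s m :
  (forall i, tnth a i <= d) -> m <= s * d ->
  sumset (dual_tuple d a) s (s * d - m) -> sumset a s m.
Proof.
move=> a_le_d le_m; case/(@sumset_dual _ _ d) => [i|_].
  by rewrite tnth_mktuple leq_subr.
by rewrite dual_tupleK ?subKn.
Qed.

(** Membership of [m] and [s * d - m] in the two semigroups is clearly
    necessary; for large [s] it is also sufficient.  If both [m] and [s * d - m]
    were too large for [sumset_of_slack], adding the two failed inequalities
    would bound [s]. *)
Lemma sumset_stable n (a : n.-tuple nat) d i0 i1 c1 c2 s m :
    0 < d -> (forall i, tnth a i <= d) -> tnth a i0 = 0 -> tnth a i1 = d ->
    (forall m', c1 <= m' -> semigroup_gen a m') ->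
    (forall m', c2 <= m' -> semigroup_gen (dual_tuple d a) m') ->
    c1 + c2 + d + d <= s -> m <= s * d ->
    semigroup_gen a m -> semigroup_gen (dual_tuple d a) (s * d - m) ->
  sumset a s m.
Proof.
move=> d_gt0 a_le_d a_i0 a_i1 S1 S2 s_large le_m Sm Sm'.
(* Otherwise the slack is on the side of [s * d - m]: the failed inequalities
   would add up to [(c1 + c2 + 2 * d) * d > s * d]. *)
case: (leqP ((c1 + d) * d + m) (s * d)) => [slack|tight].
  exact: (sumset_of_slack a_i0 a_i1 d_gt0 S1 Sm slack).
apply: sumset_dualK => //; apply: (@sumset_of_slack _ _ d i1 i0 _ _ c2) => //.
- by rewrite tnth_mktuple a_i1 subnn.
- by rewrite tnth_mktuple a_i0 subn0.
by nia.
Qed.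

End Sumsets.

(** * The decomposition as an equality of cardinals *)

Section Counting.
Local Open Scope nat_scope.

Definition finite_sumset n (a : n.-tuple nat) d s : {set 'I_(s * d).+1} :=
  [set m : 'I_(s * d).+1 | `[< sumset a s m >]]%SET.

(** The number of all gaps of [T] as soon as [T] contains every integer from
    [c] on. *)
Definition gap_count (T : set nat) c := \sum_(0 <= m < c) ~~ `[< T m >].

(** Membership in both semigroups fails exactly at the gaps of the first and
    at the reflected gaps of the second, and these do not overlap. *)
Lemma card_window (S S' : set nat) c c' N :
    (forall m, c <= m -> S m) -> (forall m, c' <= m -> S' m) -> c + c' <= N ->
  #|[set m : 'I_N.+1 | `[< S m >] && `[< S' (N - m) >]]%SET|
    + (gap_count S c + gap_count S' c') = N.+1.
Proof.
move=> Sc S'c' le_N.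
have gap_widen T b : b <= N -> (forall m, b <= m -> T m) ->
    gap_count T b = \sum_(m < N.+1) ~~ `[< T m >].
  move=> le_b Tb.
  rewrite -(big_mkord predT (fun m : nat => nat_of_bool (~~ `[< T m >]))).
  rewrite (@big_cat_nat _ _ _ b) ?(leqW le_b) //=.
  rewrite [X in _ = _ + X]big1_seq ?addn0 // => m /andP[_].
  by rewrite mem_index_iota => /andP[/Tb Tm _]; rewrite (asboolT Tm).
rewrite (gap_widen _ _ (leq_trans (leq_addr _ _) le_N) Sc).
rewrite (gap_widen _ _ (leq_trans (leq_addl _ _) le_N) S'c').
rewrite [X in _ + (_ + X)](reindex_inj rev_ord_inj) /=.
rewrite -sum1_card big_mkcond -!big_split /= -[RHS]card_ord -sum1_card.
apply: eq_bigr => m _; rewrite inE subSS.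
case: (leqP c m) => [/Sc/asboolT-> | lt_m].
  by case: `[< _ >].
have /asboolT-> : S' (N - m) by apply: S'c'; lia.
by case: `[< _ >].
Qed.

(** The predecessor of the conductor is a gap, which is why the blocks [C_i] may
    stop at [c_i - 2] without losing an element below [c_i]. *)
Lemma below_conductor_gap (T : set nat) c m :
  is_conductor T c -> T m -> m < c -> m + 2 <= c.
Proof.
case=> Tc c_min Tm lt_m; rewrite addn2 ltnNge; apply/negP => le_c.
have /c_min : forall m', m <= m' -> T m'.
  move=> m'; rewrite leq_eqVlt => /predU1P[<- // | lt_m']; apply: Tc.
  exact: leq_trans le_c lt_m'.
by rewrite leEnat leqNgt lt_m.
Qed.

Section Decomposition.
Variables (n : nat) (a : n.-tuple nat) (d c1 c2 : nat).
Hypothesis a_le_d : forall i, tnth a i <= d.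
Hypothesis conductor1 : is_conductor (semigroup_gen a) c1.
Hypothesis conductor2 : is_conductor (semigroup_gen (dual_tuple d a)) c2.

Let gaps := gap_count (semigroup_gen a) c1 +
            gap_count (semigroup_gen (dual_tuple d a)) c2.

(** An element below [c1] is automatically far enough from [s * d] to satisfy
    the condition on the second semigroup, and symmetrically near [s * d]. *)
Lemma decomposition_window s m : c1 + c2 <= s * d ->
  [/\ m <= s * d, semigroup_gen a m &
      semigroup_gen (dual_tuple d a) (s * d - m)] <->
  (below_conductor (semigroup_gen a) c1 `|` [set m | c1 <= m <= s * d - c2] `|`
   [set s * d - c | c in
      below_conductor (semigroup_gen (dual_tuple d a)) c2]) m.
Proof.
move=> le_c; have [S1 _] := conductor1; have [S2 _] := conductor2.
split=> [[le_m Sm Sm']|[[[Sm /= lt_m]|/= /andP[ge_m le_m]]|[c [Sc /= lt_c] <-]]].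
- case: (ltnP m c1) => [lt_m|ge_m].
    by left; left; split=> //; apply: below_conductor_gap conductor1 _ _.
  case: (leqP m (s * d - c2)) => [le_m'|gt_m].
    by left; right; rewrite /= ge_m.
  right; exists (s * d - m); last by rewrite subKn.
  by split=> //; apply: (below_conductor_gap conductor2) => //; lia.
- by split=> //; [|apply: S2]; lia.
- by split; [|apply: S1|apply: S2]; lia.
by split; [|apply: S1|rewrite subKn //]; lia.
Qed.

(** The window contains the sumset in all cases, so that comparing cardinals
    is enough to compare the two sets. *)
Lemma card_sumset_windowP s : c1 + c2 <= s * d ->
  #|finite_sumset a d s| + gaps = (s * d).+1 <->
  forall m, [/\ m <= s * d, semigroup_gen a m &
    semigroup_gen (dual_tuple d a) (s * d - m)] -> sumset a s m.
Proof.
move=> le_c; have [S1 _] := conductor1; have [S2 _] := conductor2.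
set W := [set m : 'I_(s * d).+1 | `[< semigroup_gen a m >] &&
            `[< semigroup_gen (dual_tuple d a) (s * d - m) >]]%SET.
have subW : finite_sumset a d s \subset W.
  apply/fintype.subsetP => m; rewrite !finset.inE => /asboolP am.
  have [_ am'] := sumset_dual a_le_d am.
  by rewrite !asboolT //; apply: sumset_semigroup; [exact: am'|exact: am].
have eqW : (#|finite_sumset a d s| + gaps == (s * d).+1)
         = (finite_sumset a d s == W).
  rewrite -(subset_leqif_cards subW).2 -[RHS](eqn_add2r gaps).
  by rewrite (card_window S1 S2 le_c).
split=> [/eqP|full].
  rewrite eqW => /eqP eqs m [le_m Sm Sm'].
  have : Ordinal (le_m : m < (s * d).+1) \in W by rewrite finset.inE !asboolT.
  by rewrite -eqs finset.inE => /asboolP.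
apply/eqP; rewrite eqW finset.eqEsubset subW; apply/fintype.subsetP => m.
rewrite !finset.inE => /andP[/asboolP Sm /asboolP Sm'].
by apply/asboolP/full; split; rewrite // -ltnS.
Qed.

Lemma decompositionP s :
  sumset_decomposition a d c1 c2 s <->
  c1 + c2 <= s * d /\ #|finite_sumset a d s| + gaps = (s * d).+1.
Proof.
split=> [[le_c eqs _ _ _]|[le_c card_eq]].
  split=> //; apply/(card_sumset_windowP le_c) => m.
  by rewrite eqs => /(decomposition_window _ le_c).
have full := (card_sumset_windowP le_c).1 card_eq.
split=> //; first (apply/seteqP; split=> m).
- move=> am; apply/(decomposition_window _ le_c).
  have [le_m am'] := sumset_dual a_le_d am.
  by split=> //; apply: sumset_semigroup; [exact: am|exact: am'].
- by move/(decomposition_window _ le_c)/full.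
- by apply/seteqP; split=> m // [[_ /= lt_m] /= /andP[ge_m _]]; lia.
- by apply/seteqP; split=> m // [[_ /= lt_m] [c [_ /= lt_c] eq_m]]; lia.
- by apply/seteqP; split=> m // [/= /andP[_ le_m] [c [_ /= lt_c] eq_m]]; lia.
Qed.

End Decomposition.

End Counting.

(** * The Hilbert function of the curve *)

Section HilbertFunction.
Variables (k : fieldType) (n : nat) (a : n.-tuple nat) (d : nat).
Hypothesis a_le_d : forall i, (tnth a i <= d)%N.

Definition weight (l : 'X_{1..n}) := (\sum_i l i * tnth a i)%N.

Lemma weight_le l : (weight l <= mdeg l * d)%N.
Proof.
rewrite mdegE big_distrl; apply: leq_sum => i _.
by rewrite leq_mul2l a_le_d orbT.
Qed.

(** The exponent of [u ^ m v ^ m']. *)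
Definition mnm2 (m m' : nat) : 'X_{1..2} := (U_(0%R) *+ m + U_(1%R) *+ m')%MM.

Lemma mnm2_injl m m' p p' : mnm2 m m' = mnm2 p p' -> m = p.
Proof.
move/mnmP/(_ 0%R); rewrite /mnm2 !mnmDE !mulmnE !mnm1E /=.
by rewrite !mul0n !mul1n !addn0.
Qed.

Lemma sumset_weightP s m :
  sumset a s m <-> exists2 l : 'X_{1..n}, mdeg l = s & m = weight l.
Proof.
rewrite sumsetP; split=> [[l ls ml]|[l ls ml]].
  exists [multinom l i | i < n]%MM; rewrite ?mdegE ?ml.
    by rewrite -ls; apply: eq_bigr => i _; rewrite mnmE.
  by apply: eq_bigr => i _; rewrite mnmE.
by exists l; rewrite // -ls mdegE.
Qed.

Lemma curve_paramX l :
  curve_param a d ('X_[l] : {mpoly k[n]})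
    = 'X_[mnm2 (weight l) (mdeg l * d - weight l)].
Proof.
rewrite /curve_param comp_mpolyX.
have -> : (mdeg l * d - weight l = \sum_i l i * (d - tnth a i))%N.
  apply/eqP; rewrite -(eqn_add2r (weight l)) subnK ?weight_le //.
  rewrite -big_split /= mdegE big_distrl; apply/eqP/eq_bigr => i _.
  by rewrite -mulnDr subnK.
rewrite /mnm2 mpolyXD -!mpolyXn /weight -!prodrXr -big_split /=.
apply: eq_bigr => i _; rewrite tnth_mktuple exprMn -!exprM.
by rewrite ![(l i * _)%N]mulnC.
Qed.

Lemma coord_proj_eq (p q : {mpoly k[n]}) :
  coord_proj a d p = coord_proj a d q <->
  curve_param a d p = curve_param a d q.
Proof.
rewrite /coord_proj; split=> [/eqP|eqpq].
  rewrite -Quotient.idealrBE inE /curve_param /= comp_mpolyB subr_eq0.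
  by move/eqP.
apply/eqP; rewrite -Quotient.idealrBE inE /curve_param /= comp_mpolyB subr_eq0.
exact/eqP.
Qed.

Lemma coord_projZ c (p : {mpoly k[n]}) :
  c *: coord_proj a d p = coord_proj a d (c *: p).
Proof. by rewrite -mul_mpolyC coord_projM. Qed.

Lemma coord_proj_sum I (r : seq I) (F : I -> {mpoly k[n]}) :
  coord_proj a d (\sum_(i <- r) F i) = \sum_(i <- r) coord_proj a d (F i).
Proof. by rewrite /coord_proj; apply: raddf_sum. Qed.

(** For each [m] in [sA] pick one monomial of degree [s] and weight [m].  Their
    images under the parametrization are distinct monomials, which gives
    independence; any other monomial of degree [s] has the same image as the
    chosen one of its weight, which gives generation. *)
Lemma has_dim_coord_grading s :
  has_dim (@coord_grading k n a d s%:Z) #|finite_sumset a d s|.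
Proof.
pose A := finite_sumset a d s.
have mono (i : 'I_#|A|) : exists l : 'X_{1..n},
    mdeg l = s /\ enum_val i = weight l :> nat.
  have := enum_valP i; rewrite inE => /asboolP/sumset_weightP[l ls lm].
  by exists l.
have [l lP] := choice mono.
have param_l i : curve_param a d ('X_[l i] : {mpoly k[n]})
    = 'X_[mnm2 (enum_val i) (s * d - enum_val i)].
  by have [ls ->] := lP i; rewrite curve_paramX ls.
exists (fun i => coord_proj a d 'X_[l i]); split.
- move=> i; exists 'X_[l i] => //=.
  by rewrite dhomogX; apply/eqP; have [ls _] := lP i; exact: ls.
- move=> c; under eq_bigr do rewrite coord_projZ.
  rewrite -coord_proj_sum => sum0 i.
  have /coord_proj_eq : coord_proj a d (\sum_j c j *: 'X_[l j]) = coord_proj a d 0.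
    by rewrite sum0 /coord_proj raddf0.
  rewrite /curve_param comp_mpoly0 raddf_sum /=.
  move/(congr1 (fun p => p@_(mnm2 (enum_val i) (s * d - enum_val i)))).
  rewrite mcoeff0 raddf_sum /= (bigD1 i) //= big1 => [|j ji].
    rewrite addr0 comp_mpolyZ mcoeffZ -/(curve_param _ _ _) param_l mcoeffX.
    by rewrite eqxx mulr1.
  rewrite comp_mpolyZ mcoeffZ -/(curve_param _ _ _) param_l mcoeffX.
  case: eqP => [/mnm2_injl/ord_inj/enum_val_inj ij|_]; last by rewrite mulr0.
  by rewrite ij eqxx in ji.
move=> _ [p /= p_homog <-].
rewrite [p]mpolyE coord_proj_sum big_seq.
apply: (big_ind (fun x => exists c : 'I_#|A| -> k,
  x = \sum_i c i *: coord_proj a d 'X_[l i])).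
- by exists (fun=> 0); rewrite big1 // => i _; rewrite scale0r.
- move=> _ _ [c ->] [e ->]; exists (fun i => c i + e i).
  by rewrite -big_split; apply: eq_bigr => i _; rewrite scalerDl.
move=> m /(dhomogP _ _ _ p_homog) ms.
have am : sumset a s (weight m) by apply/sumset_weightP; exists m.
have lt_m : (weight m < (s * d).+1)%N by rewrite ltnS -ms weight_le.
have mA : Ordinal lt_m \in A by rewrite inE; apply/asboolP.
pose j := enum_rank_in mA (Ordinal lt_m).
exists (fun i => if i == j then p@_m else 0).
rewrite (bigD1 j) //= eqxx big1 => [|i /negPf->]; last by rewrite scale0r.
rewrite addr0 coord_projZ; apply/coord_proj_eq.
rewrite /curve_param !comp_mpolyZ -!/(curve_param _ _ _) param_l curve_paramX.
by rewrite enum_rankK_in // ms.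
Qed.

End HilbertFunction.

(** * The regularity of a function that is eventually a line *)

Section Regularity.
Variables (d gaps : nat) (h : nat -> nat).
Hypothesis d_gt1 : (1 < d)%N.

Definition hilbert_extension (s : int) : nat :=
  if s is Posz m then h m else 0%N.

Definition line_poly : {poly rat} := d%:R *: 'X + (1 - gaps%:R)%:P.

Lemma horner_line_poly x : line_poly.[x] = d%:R * x + 1 - gaps%:R.
Proof. by rewrite /line_poly !hornerE. Qed.

Lemma line_poly_nat (m : nat) :
  line_poly.[m%:Z%:~R] = (h m)%:R <-> (h m + gaps = (m * d).+1)%N.
Proof.
rewrite horner_line_poly -pmulrn -natrM mulnC natr1.
split=> [/eqP|eqh]; last apply/eqP.
  by rewrite subr_eq -natrD eqr_nat => /eqP->.
by rewrite subr_eq -natrD eqr_nat eqh.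
Qed.

(** At [-1] the value [1 - d - gaps] is negative because [d > 1], and the slope
    is positive. *)
Lemma line_poly_neg (m : nat) : line_poly.[(Negz m)%:~R] < 0.
Proof.
rewrite horner_line_poly NegzE mulrNz -pmulrn mulrN -natrM.
rewrite subr_lt0 addrC; apply: (@lt_le_trans _ _ 0); rewrite ?ler0n //.
rewrite subr_lt0 ltr1n; nia.
Qed.

(** Negative arguments never count towards agreement, so the integer regularity
    is the least natural number from which [h] follows the line. *)
Lemma regularity_of_eventually_line (s0 : nat) :
    (forall s, s0 <= s -> h s + gaps = (s * d).+1)%N ->
  exists r : nat, is_hilbert_polynomial hilbert_extension line_poly /\
  is_least [set r' : int | agree_from hilbert_extension line_poly r'] r%:Z /\
  forall s', (forall s, s' <= s -> h s + gaps = (s * d).+1)%N <-> (r <= s')%N.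
Proof.
move=> s0P.
have ex_r : exists r : nat,
    `[< forall s : nat, (r <= s)%N -> (h s + gaps = (s * d).+1)%N >].
  by exists s0; apply/asboolP.
have [r /asboolP rP r_min] := ex_minnP ex_r.
have r_least s' :
    (forall s, s' <= s -> h s + gaps = (s * d).+1)%N <-> (r <= s')%N.
  split=> [s'P|le_r s /(leq_trans le_r)]; last exact: rP.
  by apply: r_min; apply/asboolP.
have agree_r : agree_from hilbert_extension line_poly r%:Z.
  by case=> [m|//] le_m; apply/line_poly_nat/rP.
exists r; split; first by exists r%:Z.
split=> //; split=> // -[m|m] agree_m.
  by apply/(r_least m) => s le_s; apply/line_poly_nat; apply: (agree_m s%:Z).
by have := line_poly_neg m; rewrite (agree_m (Negz m)).
Qed.

End Regularity.

Lemma ceil_ratio_le (c d s : nat) : (0 < d)%N ->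
  (Num.ceil (c%:R / d%:R : rat) <= s%:Z) = (c <= s * d)%N.
Proof.
move=> d_gt0; rewrite ceil_le_int ler_pdivrMr ?ltr0n //.
by rewrite -pmulrn -natrM ler_nat.
Qed.

(** * The least stabilization index *)

Lemma strict_tuple_ends n (a : n.-tuple nat) d :
    (2 < n)%N -> sorted ltn a -> nth 0%N a 0 = 0%N -> nth 0%N a n.-1 = d ->
  [/\ (1 < d)%N, forall i, (tnth a i <= d)%N,
      exists i, tnth a i = 0%N & exists i, tnth a i = d].
Proof.
move=> n_gt2 a_incr a0 ad.
have lt_a i j : (i < j < n)%N -> (nth 0 a i < nth 0 a j)%N.
  move=> /andP[lt_ij lt_j]; apply: (sorted_ltn_nth ltn_trans) => //.
    by rewrite inE size_tuple (ltn_trans lt_ij).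
  by rewrite inE size_tuple.
split.
- have lt01 : (nth 0 a 0 < nth 0 a 1)%N by apply: lt_a; lia.
  have lt12 : (nth 0 a 1 < nth 0 a n.-1)%N by apply: lt_a; lia.
  by rewrite -ad; apply: leq_trans lt12; rewrite ltnS; apply: leq_trans lt01.
- move=> i; rewrite (tnth_nth 0%N) -ad.
  have [->//|ne_i] := eqVneq (i : nat) n.-1.
  by apply/ltnW/lt_a; have := ltn_ord i; lia.
- have lt0 : (0 < n)%N by lia.
  by exists (Ordinal lt0); rewrite (tnth_nth 0%N).
have lt1 : (n.-1 < n)%N by lia.
by exists (Ordinal lt1); rewrite (tnth_nth 0%N).
Qed.

Theorem theorem3p1 (k : fieldType) (k_infinite : infinite_set [set: k])
  (n : nat) (n_ge4 : (4 <= n)%N)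
  (a : n.-tuple nat) (d : nat)
  (a_incr : sorted ltn a)
  (a_first : nth 0%N a 0 = 0%N)
  (a_last : nth 0%N a n.-1 = d)
  (a_gcd : \big[gcdn/0%N]_(1 <= i < n) nth 0%N a i = 1%N)
  (c1 c2 : nat)
  (c1_conductor : is_conductor (semigroup_gen a) c1)
  (c2_conductor : is_conductor (semigroup_gen (dual_tuple d a)) c2) :
  exists (r : int) (sigma : nat),
    [/\ is_hilbert_regularity (@coord_grading k n a d) r,
        is_least [set sigma' : nat | forall s : nat, (sigma' <= s)%N ->
                    sumset_decomposition a d c1 c2 s] sigma
      & sigma%:Z = Num.max r (Num.ceil ((c1 + c2)%:R / d%:R : rat))].
Proof.
have [d_gt1 a_le_d [i0 a_i0] [i1 a_i1]] :=
  strict_tuple_ends (ltnW n_ge4) a_incr a_first a_last.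
have d_gt0 := ltnW d_gt1.
set gaps := (gap_count (semigroup_gen a) c1 +
  gap_count (semigroup_gen (dual_tuple d a)) c2)%N.
have decP := decompositionP a_le_d c1_conductor c2_conductor.
rewrite -/gaps in decP.
have stable s : (c1 + c2 + d + d <= s)%N ->
    (#|finite_sumset a d s| + gaps = (s * d).+1)%N.
  move=> s_large; apply/card_sumset_windowP => //; first by nia.
  move=> m [le_m Sm Sm'].
  have [S1 _] := c1_conductor; have [S2 _] := c2_conductor.
  exact: (sumset_stable d_gt0 a_le_d a_i0 a_i1 S1 S2 s_large le_m Sm Sm').
have [r [hilbP [r_least rP]]] := regularity_of_eventually_line d_gt1 stable.
set q := Num.ceil _.
have q_le s : (q <= s%:Z) = (c1 + c2 <= s * d)%N := ceil_ratio_le _ _ d_gt0.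
(* [sigma] is a natural number because [r] is one. *)
have sigma_ge0 : 0 <= Num.max r%:Z q by rewrite le_max.
exists r%:Z, `|Num.max r%:Z q|%N; rewrite gez0_abs //; split=> //.
  exists (hilbert_extension (fun s => #|finite_sumset a d s|)), (line_poly d gaps).
  split=> //; case=> s; first exact: has_dim_coord_grading.
  exists (fun=> 0); split=> [[]//|c _ []//|x ->].
  by exists (fun=> 0); rewrite big_ord0.
split=> [s|s' sP].
  rewrite -lez_nat gez0_abs // ge_max q_le lez_nat => /andP[le_r le_q].
  by apply/decP; split=> //; apply: (rP r).2.
rewrite leEnat -lez_nat gez0_abs // ge_max q_le; apply/andP; split.
  by apply/(rP s') => s /sP/decP[].
by have /decP[] := sP s' (leqnn _).
Qed.
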